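(* Let $d\in\mathbb N$, $a\in\mathbb R$, $b\in[a,\infty)$, a measure $\mu\colon\mathcal B([a,b]^d)\to[0,\infty]$, a bounded measurable $f\colon[a,b]^d\to\mathbb R$, and $k\in\mathbb N$ be given, let $\sigma\colon\mathbb R\to\mathbb R$ satisfy $\sigma(x)=(\max\{x,0\})^k$ for all $x\in\mathbb R$, let $D_h$, $\mathcal N_h^\theta$, $\mathcal L_h$ (assumed real-valued), $\mathbb I_h$ be the associated shallow-network objects and let $(\Omega,\mathcal F,\mathbb P)$, $X_n^m$, $Y_n^m$, $M_n^h$, $\mathfrak L_n^h$, $\mathfrak G_n^h$, $\Phi_n^h$, $\Theta_n^h$ ($m,n,h\in\mathbb N_0$) form a generalized stochastic gradient method, all as defined in the context. Let $h\in\mathbb N$, assume that the random vectors $$(\Theta_0^{h,(i-1)d+1},\Theta_0^{h,(i-1)d+2},\dots,\Theta_0^{h,(i-1)d+d},\Theta_0^{h,hd+i})\colon\Omega\to\mathbb R^{d+1},\qquad i\in\{1,\dots,h\},$$ are i.i.d., and assume $\{\theta\in\mathbb R^{D_{h-1}}\colon\mathcal L_{h-1}(\theta)=\mathbb I_{h-1}>0\}\ne\emptyset$. Then $$\mathbb P\Bigl(\liminf_{n\to\infty}\mathcal L_h(\Theta_n^h)\le\mathbb I_h\Bigr)\le\exp\Bigl(-h\,\mathbb P\Bigl(\sum_{j=1}^d\max\{\Theta_0^{h,j}a,\Theta_0^{h,j}b\}<-\Theta_0^{h,hd+1}\Bigr)\Bigr).$$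
   Context: Shallow networks. For $h\in\mathbb N_0$ let $D_h=dh+2h+1$, and for $\theta\in\mathbb R^{D_h}$ let $\mathcal N_h^\theta\colon\mathbb R^d\to\mathbb R$, $$\mathcal N_h^\theta(x)=\theta_{dh+2h+1}+\sum_{i=1}^h\theta_{dh+h+i}\,\sigma\Bigl(\theta_{dh+i}+\sum_{j=1}^d\theta_{(i-1)d+j}x_j\Bigr),$$ $\mathcal L_h(\theta)=\int_{[a,b]^d}(\mathcal N_h^\theta(x)-f(x))^2\,\mu(dx)$, where $\mathcal L_h\colon\mathbb R^{D_h}\to\mathbb R$ is assumed real-valued for every $h\in\mathbb N_0$ (so $\mu$ is finite), and $\mathbb I_h=\inf_{\theta\in\mathbb R^{D_h}}\mathcal L_h(\theta)$. Generalized stochastic gradient method. $(\Omega,\mathcal F,\mathbb P)$ is a probability space; for $m,n\in\mathbb N_0$, $X_n^m\colon\Omega\to[a,b]^d$ and $Y_n^m\colon\Omega\to\mathbb R$ are random variables. For every $h,n\in\mathbb N_0$: $M_n^h\in\mathbb N$; $\mathfrak L_n^h\colon\mathbb R^{D_h}\times\Omega\to\mathbb R$ is $\mathfrak L_n^h(\theta)=\frac1{M_n^h}\sum_{m=1}^{M_n^h}|\mathcal N_h^\theta(X_n^m)-Y_n^m|^2$; $\mathfrak G_n^h=(\mathfrak G_n^{h,1},\dots,\mathfrak G_n^{h,D_h})\colon\mathbb R^{D_h}\times\Omega\to\mathbb R^{D_h}$ is a function such that for all $i\in\{1,\dots,h\}$, $j\in\{(i-1)d+1,\dots,(i-1)d+d\}\cup\{hd+i\}$,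 $\theta\in\mathbb R^{D_h}$ and all $\omega\in\Omega$ for which $\mathbb R^{d+1}\ni(\psi_1,\dots,\psi_{d+1})\mapsto\mathfrak L_n^h(\theta_1,\dots,\theta_{(i-1)d},\psi_1,\dots,\psi_d,\theta_{id+1},\dots,\theta_{dh+i-1},\psi_{d+1},\theta_{dh+i+1},\dots,\theta_{D_h},\omega)$ is differentiable at $(\theta_{(i-1)d+1},\dots,\theta_{id},\theta_{hd+i})$ one has $\mathfrak G_n^{h,j}(\theta,\omega)=(\frac{\partial}{\partial\theta_j}\mathfrak L_n^h)(\theta,\omega)$; $\Theta_n^h=(\Theta_n^{h,1},\dots,\Theta_n^{h,D_h})\colon\Omega\to\mathbb R^{D_h}$ is a random variable; $\Phi_n^h=(\Phi_n^{h,1},\dots,\Phi_n^{h,D_h})\colon(\mathbb R^{D_h})^{n+1}\to\mathbb R^{D_h}$ is a function such that for all $g=((g_{i,j})_{j\in\{1,\dots,D_h\}})_{i\in\{0,\dots,n\}}\in(\mathbb R^{D_h})^{n+1}$ and $j\in\{1,\dots,D_h\}$ with $\sum_{i=0}^n|g_{i,j}|=0$ one has $\Phi_n^{h,j}(g)=0$; and $\Theta_{n+1}^h=\Theta_n^h-\Phi_n^h(\mathfrak G_0^h(\Theta_0^h),\mathfrak G_1^h(\Theta_1^h),\dots,\mathfrak G_n^h(\Theta_n^h))$, where $\mathfrak G_n^h(\Theta_n^h)$ means $\omega\mapsto\mathfrak G_n^h(\Theta_n^h(\omega),\omega)$. *)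

(* Defs.v *)
From HB Require Import structures.
From mathcomp Require Import all_boot all_order all_algebra.
From mathcomp Require Import all_classical all_reals all_analysis.

Set Implicit Arguments.
Unset Strict Implicit.
Unset Printing Implicit Defensive.

Import Order.TTheory GRing.Theory Num.Theory.
Import numFieldNormedType.Exports.

Local Open Scope classical_set_scope.
Local Open Scope ring_scope.

(* [n -> R] row vectors with their Borel sigma-algebra; convertible to
   ['rV[R]_n], which itself carries no measurable structure. *)
Definition borel_rV (R : realType) (n : nat) :=
  g_sigma_algebraType [set A : set 'rV[R]_n | open A].

HB.instance Definition _ (R : realType) (n : nat) :=
  Measurable.on (borel_rV R n).

Definition cube (R : realType) (d : nat) (a b : R) : set (borel_rV R d) :=
  [set x : 'rV[R]_d | forall j, a <= x 0 j <= b].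

Section independence.
Local Open Scope ereal_scope.
Context {dO dT : measure_display} {Omega : measurableType dO}
  {T : measurableType dT} {R : realType} (P : probability Omega R)
  {I : finType}.

Definition mutually_independent (Z : I -> Omega -> T) :=
  forall (J : {set I}) (B : I -> set T),
    (forall i, i \in J -> measurable (B i)) ->
    P (\bigcap_(i in [set` J]) Z i @^-1` B i) =
    \prod_(i in J) P (Z i @^-1` B i).

Definition identically_distributed (Z : I -> Omega -> T) :=
  forall (i j : I) (B : set T), measurable B ->
    pushforward P (Z i) B = pushforward P (Z j) B.

(* The measurability clause says that the [Z i] are random variables. *)
Definition iid (Z : I -> Omega -> T) :=
  [/\ forall i, measurable_fun setT (Z i),
      mutually_independent Z & identically_distributed Z].

End independence.

(* Number of parameters of a shallow network with d inputs and h neurons. *)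
Definition nparam (d h : nat) : nat := (d * h + 2 * h + 1)%N.

(* The four kinds of coordinates of a parameter vector. All indices start
   from 0, so theta_p in the usual notation is [theta 0 (p - 1)], and neuron
   i in {1, ..., h} is [i - 1 : 'I_h]. *)
Section parameter_indices.
Context {d h : nat}.

Fact weight_subproof (i : 'I_h) (j : 'I_d) : (i * d + j < nparam d h)%N.
Proof.
have : (i * d + j < h * d)%N.
  by rewrite (@leq_trans (i.+1 * d)%N)// ?leq_mul2r ?ltn_ord ?orbT// mulSnr ltn_add2l.
by move=> /leq_trans; apply; rewrite /nparam mulnC -addnA leq_addr.
Qed.

Fact bias_subproof (i : 'I_h) : (d * h + i < nparam d h)%N.
Proof.
by rewrite /nparam mul2n -addnn addn1 ltnS leq_add2l ltnW// ltn_addr.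
Qed.

Fact outer_subproof (i : 'I_h) : (d * h + h + i < nparam d h)%N.
Proof.
by rewrite /nparam mul2n -addnn addn1 ltnS addnA leq_add2l ltnW.
Qed.

Fact const_subproof : (d * h + 2 * h < nparam d h)%N.
Proof. by rewrite /nparam addn1. Qed.

Definition weight_idx (i : 'I_h) (j : 'I_d) := Ordinal (weight_subproof i j).
Definition bias_idx (i : 'I_h) := Ordinal (bias_subproof i).
Definition outer_idx (i : 'I_h) := Ordinal (outer_subproof i).
Definition const_idx := Ordinal const_subproof.

(* The inner parameters of neuron i: its d weights, followed by its bias. *)
Definition inner_idx (i : 'I_h) (l : 'I_(d + 1)) : 'I_(nparam d h) :=
  match fintype.split l with inl j => weight_idx i j | inr _ => bias_idx i end.

End parameter_indices.

Section networks.
Context {R : realType} {d h : nat}.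
Implicit Types (theta : 'rV[R]_(nparam d h)) (x : 'rV[R]_d).

Definition network (sigma : R -> R) theta x : R :=
  theta 0 const_idx + \sum_(i < h) theta 0 (outer_idx i) *
    sigma (theta 0 (bias_idx i) + \sum_(j < d) theta 0 (weight_idx i j) * x 0 j).

Definition inner theta (i : 'I_h) : 'rV[R]_(d + 1) :=
  \row_l theta 0 (inner_idx i l).

(* [theta] with the inner parameters of neuron i replaced by [psi]. *)
Definition set_inner theta (i : 'I_h) (psi : 'rV[R]_(d + 1)) :
    'rV[R]_(nparam d h) :=
  \row_p if [pick l | inner_idx i l == p] is Some l then psi 0 l
         else theta 0 p.

Definition risk (sigma : R -> R) (a b : R)
    (mu : {measure set (borel_rV R d) -> \bar R}) (f : borel_rV R d -> R)
    theta : \bar R :=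
  (\int[mu]_(x in cube a b) ((network sigma theta x - f x) ^+ 2)%:E)%E.

Definition empirical_risk (sigma : R -> R) (M : nat) (x : nat -> 'rV[R]_d)
    (y : nat -> R) theta : R :=
  M%:R^-1 * \sum_(1 <= m < M.+1) `|network sigma theta (x m) - y m| ^+ 2.

End networks.

Definition inf_risk (R : realType) (d h : nat) (sigma : R -> R) (a b : R)
    (mu : {measure set (borel_rV R d) -> \bar R}) (f : borel_rV R d -> R) :
    \bar R :=
  ereal_inf (range (@risk R d h sigma a b mu f)).

(* [G] agrees with the partial derivatives of [L] in the inner parameters of
   neuron i wherever [L] is differentiable in these parameters jointly. *)
Definition generalized_gradient (R : realType) (d h : nat)
    (L : 'rV[R]_(nparam d h) -> R)
    (G : 'rV[R]_(nparam d h) -> 'rV[R]_(nparam d h)) :=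
  forall (i : 'I_h) (l : 'I_(d + 1)) (theta : 'rV[R]_(nparam d h)),
    differentiable (fun psi : 'rV[R]_(d + 1) => L (set_inner theta i psi))
      (inner theta i) ->
    G theta 0 (inner_idx i l) = 'D_(delta_mx 0 (inner_idx i l)) L theta.

(* Main.v *)
Require Import Defs.
From mathcomp Require Import all_boot all_order all_algebra.
From mathcomp Require Import all_classical all_reals all_analysis.
From mathcomp Require Import measurable_realfun ring lra.

(* A neuron whose initial inner parameters make its preactivation negative on
   the whole cube stays inactive on a neighbourhood of these parameters, so the
   generalized gradient vanishes in its inner coordinates and they never move:
   all iterates realize networks with h - 1 neurons, and their risk is at least
   I_(h-1). By independence, this happens to some neuron with probability at
   least 1 - (1 - p)^h >= 1 - exp (- h p), so it remains to see that
   I_h < I_(h-1).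

   If I_h >= I_(h-1), the residual g of an optimal network with h - 1 neurons
   is orthogonal to every neuron x |-> sigma (b + w.x). The functions orthogonal
   to g are closed under linear combinations and bounded pointwise limits.
   Difference quotients in b lower the power k down to the indicators of
   half-spaces, step functions then give x |-> exp (w.x), and the limits
   exp (- exp (n + n^2 (t - c))) -> 1_(t < c) give the indicators of boxes,
   which generate the Borel sets. Hence g = 0 almost everywhere and
   I_(h-1) = 0. *)

Set Implicit Arguments.
Unset Strict Implicit.
Unset Printing Implicit Defensive.

Import Order.TTheory GRing.Theory Num.Theory.
Import numFieldNormedType.Exports.

Local Open Scope classical_set_scope.
Local Open Scope ring_scope.

(** * Functions orthogonal to a bounded function *)

Section annihilator.
Context {dT : measure_display} {T : measurableType dT} {R : realType}.
Variables (mu : {measure set T -> \bar R}) (D : set T) (g : T -> R).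

(** Measurability and boundedness travel with orthogonality so that, on a set of finite measure,
    products with [g] stay integrable and bounded limits pass under the integral. *)
Definition annihilated (phi : T -> R) :=
  [/\ measurable_fun D phi,
      exists C : R, forall x, D x -> `|phi x| <= C &
      (\int[mu]_(x in D) (g x * phi x)%:E = 0)%E].

Hypotheses (mD : measurable D) (muD : (mu D < +oo)%E).
Hypotheses (mg : measurable_fun D g) (bg : exists C : R, forall x, D x -> `|g x| <= C).

Lemma bounded_integrable (phi : T -> R) :
  measurable_fun D phi -> (exists C : R, forall x, D x -> `|phi x| <= C) ->
  mu.-integrable D (EFin \o phi).
Proof.
move=> mphi [C phiC]; apply: measurable_bounded_integrable => //.
exists C; split; first by rewrite num_real.
by move=> M CM x Dx; apply: le_trans (phiC _ Dx) (ltW CM).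
Qed.

Lemma bounded_mul (phi psi : T -> R) :
  (exists C : R, forall x, D x -> `|phi x| <= C) ->
  (exists C : R, forall x, D x -> `|psi x| <= C) ->
  exists C : R, forall x, D x -> `|phi x * psi x| <= C.
Proof.
move=> [C phiC] [E psiE]; exists (C * E) => x Dx.
by rewrite normrM ler_pM ?phiC ?psiE.
Qed.

Lemma integrable_gmul (phi : T -> R) :
  measurable_fun D phi -> (exists C : R, forall x, D x -> `|phi x| <= C) ->
  mu.-integrable D (fun x => (g x * phi x)%:E).
Proof.
move=> mphi bphi; apply: (@bounded_integrable (fun x => g x * phi x)).
  exact: measurable_funM.
exact: bounded_mul.
Qed.

Lemma annihilated_ext (phi psi : T -> R) :
  (forall x, D x -> phi x = psi x) -> annihilated phi -> annihilated psi.
Proof.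
move=> e [m [C c] i]; split.
- by apply: eq_measurable_fun m => x; rewrite inE => /e.
- by exists C => x Dx; rewrite -e// c.
- by rewrite -i; apply: eq_integral => x; rewrite inE => Dx; rewrite e.
Qed.

Lemma annihilated0 : annihilated (fun=> 0).
Proof.
split; [exact: measurable_cst|by exists 0 => x _; rewrite normr0|].
by under eq_integral do rewrite mulr0; rewrite integral0.
Qed.

Lemma annihilatedD (phi psi : T -> R) :
  annihilated phi -> annihilated psi -> annihilated (fun x => phi x + psi x).
Proof.
move=> [m [C c] i] [m' [C' c'] i']; split.
- exact: measurable_funD.
- by exists (C + C') => x Dx; apply: le_trans (ler_normD _ _) _; rewrite lerD ?c ?c'.
- under eq_integral do rewrite mulrDr EFinD.
  rewrite integralD//=.
  + by rewrite i i' adde0.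
  + by apply: integrable_gmul => //; exists C.
  + by apply: integrable_gmul => //; exists C'.
Qed.

Lemma annihilatedZ (r : R) (phi : T -> R) :
  annihilated phi -> annihilated (fun x => r * phi x).
Proof.
move=> [m [C c] i]; split.
- by apply: measurable_funM => //; exact: measurable_cst.
- by exists (`|r| * C) => x Dx; rewrite normrM ler_wpM2l ?c.
- under eq_integral do rewrite mulrCA EFinM.
  rewrite integralZl//=; first by rewrite i mule0.
  by apply: integrable_gmul => //; exists C.
Qed.

Lemma annihilated_sum (I : Type) (s : seq I) (phi : I -> T -> R) :
  (forall i, annihilated (phi i)) -> annihilated (fun x => \sum_(i <- s) phi i x).
Proof.
move=> h; elim: s => [|i s IHs].
  by apply: annihilated_ext annihilated0 => x _; rewrite big_nil.
by apply: annihilated_ext (annihilatedD (h i) IHs) => x _; rewrite big_cons.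
Qed.

(** Dominated convergence: [g] and all [phi_ n] are uniformly bounded, so a constant dominates, and
    it is integrable because [mu D] is finite. *)
Lemma annihilated_cvg (phi_ : nat -> T -> R) (phi : T -> R) (C : R) :
  (forall n, annihilated (phi_ n)) ->
  (forall n x, D x -> `|phi_ n x| <= C) ->
  (forall x, D x -> phi_ n x @[n --> \oo] --> phi x) ->
  annihilated phi.
Proof.
move=> aphi phiC cphi.
have mphi_ n : measurable_fun D (phi_ n) by case: (aphi n).
have mphi : measurable_fun D phi by exact: measurable_realfun.measurable_fun_cvg cphi.
have phiCl x : D x -> `|phi x| <= C.
  move=> Dx; apply: (@cvgr_to_le _ \oo _ _ (fun n => `|phi_ n x|)).
    by apply: cvg_norm; exact: cphi.
  by near=> n; exact: phiC.
split => //; first by exists C.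
have [Cg gC] := bg.
have : (\int[mu]_(x in D) (g x * phi_ n x)%:E)%E @[n --> \oo] -->
    (\int[mu]_(x in D) (g x * phi x)%:E)%E.
  apply: (dominated_cvg mD (g := cst (Cg * C)%:E)) => //.
  - by move=> n; apply/measurable_EFinP; exact: measurable_funM.
  - move=> x Dx; apply: cvg_EFin; first by near=> n.
    by apply: cvgM; [exact: cvg_cst|exact: cphi].
  - by apply: (@bounded_integrable (cst (Cg * C))) => //; exists `|Cg * C|.
  - move=> n x Dx; rewrite /= lee_fin normrM.
    by apply: ler_pM => //; [exact: gC|exact: phiC].
rewrite [X in X @ \oo](_ : _ = cst 0%E); last first.
  by apply/funext => n; case: (aphi n).
by move=> /cvg_lim <- //; rewrite lim_cst.
Unshelve. all: by end_near.
Qed.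

End annihilator.

(** * Ridge functions: from rectified powers to indicators of boxes *)

Section ridge_functions.
Context {dT : measure_display} {T : measurableType dT} {R : realType}.
Variables (mu : {measure set T -> \bar R}) (D : set T) (g : T -> R).
Hypotheses (mD : measurable D) (muD : (mu D < +oo)%E).
Hypotheses (mg : measurable_fun D g) (bg : exists C : R, forall x, D x -> `|g x| <= C).
Local Notation annihilated := (annihilated mu D g).

(* The first factor only matters for [k = 0]. *)
Definition pospow (k : nat) (y : R) := (0 < y)%R%:R * y ^+ k.

Lemma pospow_le0 k (y : R) : y <= 0 -> pospow k y = 0.
Proof. by move=> y0; rewrite /pospow ltNge y0 mul0r. Qed.

(** Since [y - e] is positive too, both indicators are 1, and factoring the difference of powers
    cancels [e]. *)
Lemma pospow_diffE k (y e : R) : 0 < e -> e < y ->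
  e^-1 * (pospow k.+1 y - pospow k.+1 (y - e)) =
  \sum_(i < k.+1) y ^+ (k - i) * (y - e) ^+ i.
Proof.
move=> e0 ey; rewrite /pospow (lt_trans e0 ey) subr_gt0 ey !mul1r subrXX/=.
by rewrite opprB addrC subrK mulKf// gt_eqF.
Qed.

(** Backward differences make every quotient vanish for [y <= 0]; with [k = 0], forward ones would
    give 1 instead of 0 at [y = 0]. *)
Lemma pospow_diff_cvg k (y : R) :
  (n.+1%:R * (pospow k.+1 y - pospow k.+1 (y - n.+1%:R^-1))) @[n --> \oo] -->
  k.+1%:R * pospow k y.
Proof.
have [y0|y0] := leP y 0.
  have y'0 n : y - n.+1%:R^-1 <= 0.
    by rewrite (le_trans _ y0)// gerBl invr_ge0.
  under eq_fun do rewrite !pospow_le0// subrr mulr0.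
  rewrite pospow_le0// mulr0.
  exact: cvg_cst.
have -> : k.+1%:R * pospow k y = \sum_(i < k.+1) y ^+ (k - i) * (y - 0) ^+ i.
  rewrite subr0 /pospow y0 mul1r.
  rewrite (eq_bigr (fun=> y ^+ k)) ?sumr_const ?card_ord ?mulr_natl// => i _.
  by rewrite -exprD subnK// -ltnS.
apply: (@cvg_trans _ ((fun n => \sum_(i < k.+1)
    y ^+ (k - i) * (y - n.+1%:R^-1) ^+ i) @ \oo)).
  apply: near_eq_cvg; near=> n.
  rewrite -[in X in _ = X * _](invrK n.+1%:R) pospow_diffE ?invr_gt0//.
  near: n; exact: (near_infty_natSinv_lt (PosNum y0)).
apply: cvg_big => [|i _]; first exact: add_continuous.
apply: cvgM; first exact: cvg_cst.
apply: (@continuous_cvg _ R R \oo _ (fun n => y - n.+1%:R^-1) (fun x : R => x ^+ i)).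
  exact: exprn_continuous.
by apply: cvgB; [exact: cvg_cst|exact: cvg_harmonic].
Unshelve. all: by end_near.
Qed.

(** Uniformity in [n] is what [annihilated_cvg] requires. *)
Lemma pospow_diff_bound k (y K : R) n : y <= K -> 0 <= K ->
  `|n.+1%:R * (pospow k.+1 y - pospow k.+1 (y - n.+1%:R^-1))| <= k.+1%:R * K ^+ k.
Proof.
move=> yK K0; have e0 : 0 < n.+1%:R^-1 :> R by rewrite invr_gt0.
have [y0|y0] := leP y 0.
  have y'0 : y - n.+1%:R^-1 <= 0 by rewrite (le_trans _ y0)// gerBl ltW.
  rewrite (pospow_le0 _ y0) (pospow_le0 _ y'0) subrr mulr0 normr0.
  by rewrite mulr_ge0// exprn_ge0.
(* When [y] is at most the step size, only the first term survives, and one of its powers of [y]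
   absorbs the factor [n.+1]. *)
have [ye|ey] := leP y n.+1%:R^-1.
  rewrite [pospow _ (y - _)]pospow_le0 ?subr_le0// /pospow y0 mul1r subr0 exprS mulrA.
  rewrite normrM ler_pM//; last first.
    by rewrite normrX lerXn2r ?nnegrE// gtr0_norm.
  rewrite gtr0_norm ?mulr_gt0// (@le_trans _ _ 1)//; last by rewrite ler1n.
  by rewrite mulrC -ler_pdivlMr// mul1r.
rewrite -[X in X * (pospow _ _ - _)]invrK pospow_diffE//.
apply: le_trans (ler_norm_sum _ _ _) _.
rewrite mulr_natl -[in leRHS](card_ord k.+1) -sumr_const; apply: ler_sum => i _.
have ye0 : 0 < y - n.+1%:R^-1 by rewrite subr_gt0.
have yeK : y - n.+1%:R^-1 <= K by rewrite (le_trans _ yK)// gerBl ltW.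
rewrite normrM !normrX (gtr0_norm y0) (gtr0_norm ye0).
have ik : (i <= k)%N by rewrite -ltnS.
rewrite -[in leRHS](subnK ik) exprD.
by apply: ler_pM; rewrite ?exprn_ge0 ?lerXn2r ?nnegrE// ltW.
Qed.

(** As every threshold [s] is allowed, difference quotients in [s] stay annihilated, and their limit
    has one power less; power 0 is the indicator itself. *)
Lemma annihilated_halfspace (t : T -> R) (K : R) (k : nat) :
  (forall x, D x -> `|t x| <= K) ->
  (forall s, annihilated (fun x => pospow k (t x - s))) ->
  forall s, annihilated (fun x => (s < t x)%R%:R).
Proof.
move=> tK; elim: k => [|k IHk] h s.
  apply: annihilated_ext (h s) => x _.
  by rewrite /pospow expr0 mulr1 subr_gt0.
apply: IHk => {}s.
suff : annihilated (fun x => k.+1%:R * pospow k (t x - s)).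
  move=> /(annihilatedZ mD muD mg bg k.+1%:R^-1).
  by apply: annihilated_ext => x _; rewrite mulKf.
apply: (@annihilated_cvg _ _ _ _ _ _ mD muD mg bg
    (fun n x => n.+1%:R * (pospow k.+1 (t x - s) - pospow k.+1 (t x - (s + n.+1%:R^-1))))
    _ (k.+1%:R * (K + `|s|) ^+ k)).
- move=> n; apply: (annihilatedZ mD muD mg bg).
  have := annihilatedD mD muD mg bg (h s)
    (annihilatedZ mD muD mg bg (-1) (h (s + n.+1%:R^-1))).
  by apply: annihilated_ext => x _; rewrite mulN1r.
- move=> n x Dx; rewrite opprD addrA; apply: pospow_diff_bound.
    by rewrite lerD ?(le_trans (ler_norm _) (tK _ Dx))// -normrN ler_norm.
  by rewrite addr_ge0// (le_trans _ (tK _ Dx)).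
- move=> x Dx; under eq_fun do rewrite opprD addrA.
  exact: pospow_diff_cvg.
Qed.

(** The number of positive integers below [y] is [y] rounded down by at most 1, provided that the
    count up to [N] reaches [y]. *)
Lemma sum_ltr_nat (y : R) (N : nat) : 0 <= y -> y <= N%:R ->
  y - 1 <= \sum_(i < N) (i.+1%:R < y)%R%:R <= y.
Proof.
move=> y0 yN.
(* The caps by [M] replace [y <= N], which would not survive an induction on [N]. *)
suff H (M : nat) : Num.min (y - 1) M%:R <= \sum_(i < M) (i.+1%:R < y)%R%:R <= Num.min y M%:R.
  have /andP[l r] := H N; apply/andP; split; last first.
    by rewrite (le_trans r)// ge_min lexx.
  by apply: le_trans l; rewrite le_min lexx/= (le_trans _ yN)// gerBl.
elim: M => [|M IHM].
  by rewrite big_ord0 ge_min le_min lexx y0 orbT.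
rewrite big_ord_recr/=; move: IHM; set S := \sum_(_ < _) _.
rewrite -natr1 !ge_min !le_min; case: (ltP (M%:R + 1) y) => yM /andP[/orP l /andP[r1 r2]].
  rewrite mulr1n; apply/andP; split; first by apply/orP; right; case: l => l; lra.
  by apply/andP; split; lra.
rewrite mulr0n; apply/andP; split; first by apply/orP; left; case: l => l; lra.
by apply/andP; split; lra.
Qed.

(** Up to [n.+1%:R^-1], [expR (t x)] is the mesh [n.+1%:R^-1] times the number of positive grid
    levels below it, and being above a level is a threshold condition on [t x]. *)
Lemma annihilated_expR (t : T -> R) (K : R) :
  (forall x, D x -> `|t x| <= K) ->
  (forall s, annihilated (fun x => (s < t x)%R%:R)) ->
  annihilated (fun x => expR (t x)).
Proof.
move=> tK h.
(* Enough levels to exceed [expR (t x)] everywhere on [D]. *)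
pose N n := Num.bound (n.+1%:R * expR K).
have approx n x : D x ->
    expR (t x) - n.+1%:R^-1 <=
    n.+1%:R^-1 * \sum_(i < N n) (ln (i.+1%:R / n.+1%:R) < t x)%R%:R <= expR (t x).
  move=> Dx.
  rewrite (eq_bigr (fun i : 'I_(N n) => (i.+1%:R < n.+1%:R * expR (t x))%R%:R)); last first.
    move=> i _; congr (nat_of_bool _)%:R.
    by rewrite -ltr_expR lnK ?posrE ?divr_gt0// ltr_pdivrMr// mulrC.
  have yN : n.+1%:R * expR (t x) <= (N n)%:R.
    apply: le_trans (ltW (archi_boundP _)); last by rewrite mulr_ge0// expR_ge0.
    by rewrite ler_wpM2l// ler_expR (le_trans (ler_norm _) (tK _ Dx)).
  have /andP[l r] := sum_ltr_nat (mulr_ge0 (ler0n _ n.+1) (expR_ge0 (t x))) yN.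
  by rewrite ler_pdivlMl// ler_pdivrMl// mulrBr mulfV// l.
apply: (@annihilated_cvg _ _ _ _ _ _ mD muD mg bg
    (fun n x => n.+1%:R^-1 * \sum_(i < N n) (ln (i.+1%:R / n.+1%:R) < t x)%R%:R)
    _ (expR K)).
- move=> n; apply: (annihilatedZ mD muD mg bg).
  by apply: (annihilated_sum mD muD mg bg) => i; exact: h.
- move=> n x Dx; have /andP[_ r] := approx n x Dx.
  rewrite ger0_norm; last by rewrite mulr_ge0 ?invr_ge0// sumr_ge0.
  by rewrite (le_trans r)// ler_expR (le_trans (ler_norm _) (tK _ Dx)).
- move=> x Dx.
  apply: (@squeeze_cvgr _ _ _ _ (fun n => expR (t x) - n.+1%:R^-1) (fun=> expR (t x))).
  + by near=> n; exact: approx.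
  + rewrite -[X in _ --> X]subr0; apply: cvgB; first exact: cvg_cst.
    exact: cvg_harmonic.
  + exact: cvg_cst.
Unshelve. all: by end_near.
Qed.

(** Dominates the exponential series uniformly in [N]: with absolute values, the partial sums
    increase to their limit. *)
Lemma sum_exp_coeff_bound (y : R) N :
  `|\sum_(0 <= i < N) exp_coeff y i| <= expR `|y|.
Proof.
apply: le_trans (ler_norm_sum _ _ _) _.
rewrite (_ : \sum_(_ <= _ < _) _ = series (exp_coeff `|y|) N); last first.
  apply: eq_bigr => i _; rewrite /exp_coeff/= normrM normrX.
  by rewrite [X in _ * X]ger0_norm// invr_ge0.
apply: (nondecreasing_cvgn_le _ (is_cvg_series_exp_coeff _)).
apply/nondecreasing_seqP => n; rewrite /series/= big_nat_recr//= lerDl.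
by rewrite exp_coeff_ge0.
Qed.

(** For [u < 0] the quadratic term wins and the inner exponential tends to 0; for [u >= 0],
    including [u = 0], the linear term alone drives it to infinity. *)
Lemma cvg_expRNexpR (u : R) :
  expR (- expR (n%:R + (n * n)%:R * u)) @[n --> \oo] --> ((u < 0)%R%:R : R).
Proof.
have [u0|u0] := ltP u 0.
  rewrite [X in _ --> X](_ : _ = expR (- 0)); last by rewrite oppr0 expR0.
  apply: continuous_cvg; first exact: continuous_expR.
  apply: cvgN.
  apply: (@squeeze_cvgr _ _ _ _ (fun=> 0) (fun n => expR (- n%:R))).
  - near=> n; rewrite expR_ge0/= ler_expR natrM.
    (* From here on [n * n * u <= - 2 n], so the inner exponent is at most [- n]. *)
    have : 2%:R / - u <= n%:R by near: n; exact: nbhs_infty_ger.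
    rewrite ler_pdivrMr ?oppr_gt0// => nu.
    have := ler0n R n; nra.
  - exact: cvg_cst.
  - exact: cvgn_expR.
apply: (@squeeze_cvgr _ _ _ _ (fun=> 0) (fun n => expR (- n%:R))).
- near=> n; rewrite expR_ge0/= ler_expR lerN2.
  apply: le_trans (expR_ge1Dx _).
  have : 0 <= (n * n)%:R * u by rewrite mulr_ge0.
  lra.
- exact: cvg_cst.
- exact: cvgn_expR.
Unshelve. all: by end_near.
Qed.

(* The exponential series of [exp (- exp (n + n^2 (tau - c)))] consists of
   exponentials of multiples of [tau]. *)
Lemma annihilated_cut (psi tau : T -> R) (K c : R) :
  (exists C : R, forall x, D x -> `|psi x| <= C) ->
  (forall x, D x -> `|tau x| <= K) ->
  (forall l, annihilated (fun x => psi x * expR (l * tau x))) ->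
  annihilated (fun x => psi x * (tau x < c)%R%:R).
Proof.
move=> [C psiC] tauK h.
pose y n x := expR (n%:R + (n * n)%:R * (tau x - c)).
have ah n : annihilated (fun x => psi x * expR (- y n x)).
  apply: (@annihilated_cvg _ _ _ _ _ _ mD muD mg bg
     (fun N x => psi x * \sum_(0 <= i < N) exp_coeff (- y n x) i)
     _ (C * expR (expR (n%:R + (n * n)%:R * (K + `|c|))))).
  - move=> N.
    apply: (@annihilated_ext _ _ _ _ _ _ (fun x => \sum_(0 <= i < N)
        ((-1) ^+ i / i`!%:R * expR (i%:R * (n%:R - (n * n)%:R * c))) *
        (psi x * expR ((i * (n * n))%:R * tau x)))).
      move=> x Dx; rewrite big_distrr/=; apply: eq_bigr => i _.
      rewrite /exp_coeff/= -[- y n x]mulN1r exprMn /y -expRM_natl.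
      have -> : i%:R * (n%:R + (n * n)%:R * (tau x - c)) =
        i%:R * (n%:R - (n * n)%:R * c) + (i * (n * n))%:R * tau x.
        by rewrite !natrM; ring.
      by rewrite expRD; ring.
    by apply: (annihilated_sum mD muD mg bg) => i; exact: (annihilatedZ mD muD mg bg).
  - move=> N x Dx; rewrite normrM; apply: ler_pM => //; first exact: psiC.
    apply: le_trans (sum_exp_coeff_bound _ _) _.
    rewrite normrN ger0_norm ?expR_ge0// !ler_expR lerD2l ler_wpM2l//.
    by rewrite lerD ?(le_trans (ler_norm _) (tauK _ Dx))// -normrN ler_norm.
  - move=> x Dx; apply: cvgM; first exact: cvg_cst.
    exact: is_cvg_series_exp_coeff.
(* Second limit, in [n]: as [y n x >= 0], the factor [expR (- y n x)] is at most 1 and [C]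
   dominates. *)
apply: (@annihilated_cvg _ _ _ _ _ _ mD muD mg bg
  (fun n x => psi x * expR (- y n x)) _ C) => // [n x Dx|x Dx].
  rewrite normrM (le_trans _ (psiC _ Dx))// ler_piMr//.
  by rewrite ger0_norm ?expR_ge0// expR_le1 oppr_le0 expR_ge0.
apply: cvgM; first exact: cvg_cst.
by rewrite -subr_lt0; exact: cvg_expRNexpR.
Qed.

Lemma annihilated_box (I : finType) (t : I -> T -> R) (K : R) (c : I -> R) :
  (forall i x, D x -> `|t i x| <= K) ->
  (forall w : I -> R, annihilated (fun x => expR (\sum_i w i * t i x))) ->
  annihilated (fun x => [forall i, (t i x < c i)%R]%:R).
Proof.
move=> tK h.
(* Coordinates are cut one at a time. The exponential with arbitrary [w] is kept along, since the
   next cut needs it; [w = 0] removes it at the end. *)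
suff H (s : seq I) (w : I -> R) : annihilated
    (fun x => (all (fun i => t i x < c i)%R s)%:R * expR (\sum_i w i * t i x)).
  apply: annihilated_ext (H (enum I) (fun=> 0)) => x Dx.
  rewrite big1 ?expR0 ?mulr1 => [|i _]; last by rewrite mul0r.
  congr (nat_of_bool _)%:R; apply/allP/forallP => [a i|a i _//].
  by apply: a; rewrite mem_enum.
elim: s w => [|i s IHs] w.
  by apply: annihilated_ext (h w) => x _; rewrite mul1r.
have tauK := tK i.
pose psi x := (all (fun i => t i x < c i)%R s)%:R * expR (\sum_i w i * t i x).
apply: (@annihilated_ext _ _ _ _ _ _ (fun x => psi x * (t i x < c i)%R%:R)).
  by move=> x Dx; rewrite /psi/= mulrAC -natrM mulnb andbC.
apply: annihilated_cut tauK _; first by have [] := IHs w.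
(* The extra factor [expR (l * t i x)] is absorbed by raising [w i] by [l]. *)
move=> l; apply: annihilated_ext (IHs (fun j => w j + l * (j == i)%:R)) => x Dx.
rewrite /psi -mulrA -expRD; congr (_ * expR _).
under eq_bigr do rewrite mulrDl.
rewrite big_split/=; congr +%R.
rewrite (bigD1 i)//= eqxx mulr1 big1 ?addr0// => j /negbTE ->.
by rewrite mulr0 mul0r.
Qed.

End ridge_functions.

(** * Borel sets of row vectors *)

Section borel_rV.
Context {R : realType} {n : nat}.

Lemma borel_rV_open (A : set 'rV[R]_n) : open A -> measurable (A : set (borel_rV R n)).
Proof. by move=> oA; apply: sub_sigma_algebra. Qed.

Lemma measurable_coord (j : 'I_n) :
  measurable_fun setT (fun x : borel_rV R n => x 0 j).
Proof.
apply: (measurability _ (RGenOpens.measurableE R)) => _ [_ [a [b ->]] <-].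
rewrite setTI; apply: borel_rV_open.
apply: open_comp; last exact: interval_open.
by move=> x _; exact: coord_continuous.
Qed.

(** A pi-system of open orthants, shown below to generate the Borel sets, as Dynkin induction
    demands. *)
Definition lower_boxes : set (set (borel_rV R n)) :=
  [set A | exists c : 'I_n -> R, A = [set x : 'rV[R]_n | forall j, x 0 j < c j]].

Lemma setI_closed_lower_boxes : setI_closed lower_boxes.
Proof.
move=> _ _ [c ->] [c' ->]; exists (fun j => Num.min (c j) (c' j)).
apply/seteqP; split => x /=.
  by move=> [xc xc'] j; rewrite lt_min xc xc'.
by move=> h; split => j; move: (h j); rewrite lt_min => /andP[].
Qed.

Lemma measurable_coord_lower_boxes (j : 'I_n) :
  measurable_fun setT (fun x : g_sigma_algebraType lower_boxes => x 0 j).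
Proof.
apply: (measurability _ (RGenInftyO.measurableE R)) => _ [_ [c ->] <-].
rewrite setTI.
(* A half-space in coordinate [j] is the union over [m] of the orthants that bound all other
   coordinates by [m]. *)
rewrite (_ : _ @^-1` _ = \bigcup_(m : nat) [set x : 'rV[R]_n | forall i, x 0 i <
    if i == j then c else m%:R]); last first.
  apply/seteqP; split => x /=.
    rewrite in_itv/= => xc; exists (Num.bound (\sum_i `|x 0 i|)) => // i.
    case: eqP => [->//|_].
    apply: le_lt_trans (archi_boundP _); last exact: sumr_ge0.
    by rewrite (le_trans (ler_norm _))// (bigD1 i)//= lerDl sumr_ge0.
  by move=> [m _] /(_ j); rewrite eqxx in_itv.
apply: bigcupT_measurable => m; apply: sub_sigma_algebra.
by exists (fun i => if i == j then c else m%:R).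
Qed.

(** Open sets are countable unions of boxes with rational corners, and coordinates are measurable
    for both sigma-algebras. *)
Lemma measurable_borel_rVE : @measurable _ (borel_rV R n) = <<s lower_boxes >>.
Proof.
apply/seteqP; split => A.
- apply: smallest_sub; first exact: smallest_sigma_algebra.
  move=> U oU.
  pose box (pq : 'rV[rat]_n * 'rV[rat]_n) : set 'rV[R]_n :=
    [set x | forall j, ratr (pq.1 0 j) < x 0 j < ratr (pq.2 0 j)].
  have -> : U = \bigcup_(pq in [set pq | box pq `<=` U]) box pq.
    apply/seteqP; split => [x Ux|x [pq h /h]//].
    have /nbhs_ballP[e /= e0 xeU] : nbhs x U by exact: open_nbhs_nbhs.
    have /choice[p hp] : forall j : 'I_n, exists q : rat, x 0 j - e < ratr q < x 0 j.
      move=> j; have /rat_in_itvoo[q] : x 0 j - e < x 0 j by rewrite gtrBl.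
      by rewrite in_itv/=; exists q.
    have /choice[q hq] : forall j : 'I_n, exists q : rat, x 0 j < ratr q < x 0 j + e.
      move=> j; have /rat_in_itvoo[q] : x 0 j < x 0 j + e by rewrite ltrDl.
      by rewrite in_itv/=; exists q.
    (* The corners differ from [x] by less than [e] in each coordinate, so the box lies in the ball
       of radius [e] for the sup norm. *)
    exists (\row_j p j, \row_j q j) => /=.
    + move=> y hy; apply: xeU; split => // i j; rewrite !ord1.
      rewrite /ball/= ltr_norml.
      have := hy j; have := hp j; have := hq j; rewrite !mxE; lra.
    + by move=> j; rewrite !mxE; have := hp j; have := hq j; lra.
  rewrite bigcup_mkcond.
  apply: (@countable_bigcupT_measurable _ (g_sigma_algebraType lower_boxes)) => [|pq].
    exact: countableP.
  case: ifPn => _; last exact: measurable0.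
  rewrite (_ : box pq = \bigcap_j
     ((fun x : 'rV[R]_n => x 0 j) @^-1` `]ratr (pq.1 0 j), ratr (pq.2 0 j)[)); last first.
    apply/seteqP; split => x h j; first by move=> _; rewrite /= in_itv/=; exact: h.
    by have := h j I; rewrite /= in_itv.
  apply: fin_bigcap_measurable => [|j _]; first exact: finite_finset.
  by rewrite -[X in measurable X]setTI; exact: measurable_coord_lower_boxes.
- apply: smallest_sub; first exact: smallest_sigma_algebra.
  move=> _ [c ->].
  rewrite (_ : mkset _ = \bigcap_j ((fun x : 'rV[R]_n => x 0 j) @^-1` `]-oo, c j[)); last first.
    apply/seteqP; split => x h j; first by move=> _; rewrite /= in_itv/=; exact: h.
    by have := h j I; rewrite /= in_itv.
  apply: (@fin_bigcap_measurable _ (borel_rV R n)) => [|j _]; first exact: finite_finset.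
  by rewrite -[X in measurable X]setTI; exact: measurable_coord.
Qed.

End borel_rV.

(** * Rectified powers discriminate bounded functions *)

Section discriminatory.
Context {R : realType} {d : nat}.
Variables (mu : {measure set (borel_rV R d) -> \bar R}) (D : set (borel_rV R d)).
Variable (g : borel_rV R d -> R).
Hypotheses (mD : measurable D) (muD : (mu D < +oo)%E).
Hypotheses (mg : measurable_fun D g) (bg : exists C : R, forall x, D x -> `|g x| <= C).
Local Notation annihilated := (annihilated mu D g).

Lemma annihilated_indic (E : set (borel_rV R d)) :
  (forall c : 'I_d -> R, annihilated (fun x => [forall j, (x 0 j < c j)%R]%:R)) ->
  measurable E -> annihilated (\1_E : _ -> R).
Proof.
move=> h mE; have := mE; rewrite measurable_borel_rVE; move: E {mE}.
(* The orthants with all bounds equal to [n] exhaust the space. *)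
have a1 : annihilated (\1_setT : _ -> R).
  apply: (@annihilated_cvg _ _ _ _ _ _ mD muD mg bg
    (fun n (x : borel_rV R d) => [forall j, (x 0 j < n%:R)%R]%:R) _ 1).
  - by move=> n; exact: h.
  - by move=> n x _; case: [forall _, _]; rewrite ?normr1 ?normr0.
  - move=> x _; apply: cvg_near_cst; near=> n; rewrite indicT/=.
    rewrite (_ : [forall j, _] = true)//; apply/forallP => i.
    apply: (@lt_le_trans _ _ (1 + \sum_j `|x 0 j|)).
      by rewrite (bigD1 i)//= addrCA (le_lt_trans (ler_norm _))// ltrDl ltr_wpDr// sumr_ge0.
    by near: n; exact: nbhs_infty_ger.
apply: (dynkin_induction (@measurable_borel_rVE R d) setI_closed_lower_boxes a1).
- move=> _ [c ->]; apply: annihilated_ext (h c) => x _.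
  rewrite indicE; congr (nat_of_bool _)%:R.
  by apply/forallP/idP => [xc|]; rewrite inE.
- move=> S mS aS; apply: annihilated_ext (annihilatedD mD muD mg bg a1
    (annihilatedZ mD muD mg bg (-1) aS)) => x _.
  by rewrite !indicE in_setT in_setC mulN1r; case: (x \in S); rewrite ?subrr ?subr0.
- move=> F mF tF aF.
  (* By disjointness the partial sums are themselves indicators, hence bounded by 1 uniformly in
     [n]. *)
  have sumF x n : \sum_(i <- iota 0 n) \1_(F i) x = (`[< exists2 k, (k < n)%N & F k x >])%:R :> R.
    case: asboolP => [[k kn Fkx]|nF].
      rewrite (bigD1_seq k) ?mem_iota ?iota_uniq//= indicE mem_set// big1 ?addr0// => i ik.
      rewrite indicE memNset// => Fix; move/eqP: ik; apply.
      by apply: tF => //; exists x.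
    rewrite big_seq big1// => i; rewrite mem_iota => /andP[_ ni].
    by rewrite indicE memNset// => Fix; apply: nF; exists i.
  apply: (@annihilated_cvg _ _ _ _ _ _ mD muD mg bg
    (fun n x => \sum_(i <- iota 0 n) \1_(F i) x) _ 1).
  + by move=> n; exact: (annihilated_sum mD muD mg bg).
  + by move=> n x _; rewrite sumF; case: asbool; rewrite ?normr1 ?normr0.
  + move=> x _; apply: cvg_near_cst; rewrite indicE.
    have [[k _ Fkx]|nF] := pselect ((\bigcup_k F k) x).
      exists k.+1 => // n /= kn; rewrite sumF mem_set; last by exists k.
      by rewrite (asboolT (ex_intro2 _ _ k kn Fkx)).
    near=> n; rewrite sumF memNset// asboolF// => -[k _ Fkx].
    by apply: nF; exists k.
Unshelve. all: by end_near.
Qed.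

Lemma rectified_power_discriminatory (k : nat) (K : R) :
  (forall x, D x -> forall j, `|x 0 j| <= K) ->
  (forall (w : 'I_d -> R) (b : R),
    (\int[mu]_(x in D)
      (g x * Num.max (b + \sum_j w j * x 0 j) 0 ^+ k.+1)%:E = 0)%E) ->
  ae_eq mu D (EFin \o g) (cst 0%E).
Proof.
move=> DK int0.
have lin_bound (w : 'I_d -> R) x : D x -> `|\sum_j w j * x 0 j| <= \sum_j `|w j| * K.
  move=> Dx; apply: le_trans (ler_norm_sum _ _ _) _; apply: ler_sum => j _.
  by rewrite normrM ler_wpM2l ?DK.
have mlin (w : 'I_d -> R) : measurable_fun D (fun x : borel_rV R d => \sum_j w j * x 0 j).
  apply: (@measurable_funS _ _ _ _ setT) => //.
  apply: measurable_sum => j; apply: measurable_funM; first exact: measurable_cst.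
  exact: measurable_coord.
have aexp w : annihilated (fun x => expR (\sum_j w j * x 0 j)).
  apply: (annihilated_expR mD muD mg bg (lin_bound w)).
  apply: (annihilated_halfspace mD muD mg bg (k := k.+1) (lin_bound w)) => s.
  (* The exponent is positive, so the maximum contributes 0 where the indicator in [pospow]
     vanishes. *)
  have posE x : pospow k.+1 (\sum_j w j * x 0 j - s) =
      Num.max (- s + \sum_j w j * x 0 j) 0 ^+ k.+1.
    rewrite addrC /pospow; case: ltP => [y0|y0]; first by rewrite mul1r.
    by rewrite mul0r expr0n.
  apply: (@annihilated_ext _ _ _ _ _ _
    (fun x : borel_rV R d => Num.max (- s + \sum_j w j * x 0 j) 0 ^+ k.+1)) => [x _|].
    by rewrite posE.
  split.
  - apply: measurable_funX; apply: measurable_maxr; last exact: measurable_cst.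
    by apply: measurable_funD => //; exact: measurable_cst.
  - exists ((`|s| + \sum_j `|w j| * K) ^+ k.+1) => x Dx.
    have yK : `|- s + \sum_j w j * x 0 j| <= `|s| + \sum_j `|w j| * K.
      by apply: le_trans (ler_normD _ _) _; rewrite normrN lerD2l lin_bound.
    have K0 := le_trans (normr_ge0 _) yK.
    rewrite normrX lerXn2r ?nnegrE//.
    by case: (leP 0) => //; rewrite normr0.
  - exact: int0.
have aind E : measurable E -> annihilated (\1_E : _ -> R).
  apply: annihilated_indic => c.
  by apply: (annihilated_box mD muD mg bg (K := K)) => // j x /DK.
(* It suffices that [g] integrates to 0 over every measurable subset of [D]. *)
apply: integral_ae_eq => //.
  by apply: bounded_integrable.
move=> E ED mE; rewrite integral0.
have [_ _ <-] := aind E mE.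
rewrite integral_mkcond [RHS]integral_mkcond; apply: eq_integral => x _.
rewrite !patchE indicE; case: ifPn => xE.
  by rewrite mem_set ?mulr1//; apply: ED; rewrite inE in xE.
by rewrite mulr0; case: ifP.
Qed.

End discriminatory.

(** * Networks and inactive neurons *)

Section parameters.
Context {R : realType} {d h : nat}.
Implicit Types (theta : 'rV[R]_(nparam d h)) (i : 'I_h).

Lemma inner_idx_lshift i j : inner_idx i (lshift 1 j) = weight_idx i j :> 'I_(nparam d h).
Proof. by rewrite /inner_idx (unsplitK (inl _ j)). Qed.

Lemma inner_idx_rshift i j : inner_idx i (rshift d j) = bias_idx i :> 'I_(nparam d h).
Proof. by rewrite /inner_idx (unsplitK (inr _ j)). Qed.

Lemma inner_weight theta i j : inner theta i 0 (lshift 1 j) = theta 0 (weight_idx i j).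
Proof. by rewrite mxE inner_idx_lshift. Qed.

Lemma inner_bias theta i : inner theta i 0 (rshift d ord0) = theta 0 (bias_idx i).
Proof. by rewrite mxE inner_idx_rshift. Qed.

Lemma weight_lt i (j : 'I_d) : (i * d + j < d * h)%N.
Proof.
rewrite (@leq_trans (i.+1 * d))//; first by rewrite mulSn addnC ltn_add2r.
by rewrite mulnC leq_mul2l ltn_ord orbT.
Qed.

Lemma inner_idx_lt i l : (@inner_idx d h i l < d * h + h)%N.
Proof.
rewrite /inner_idx; case: splitP => j _ /=.
  by rewrite (leq_trans (weight_lt i j))// leq_addr.
by rewrite ltn_add2l.
Qed.

(** Weights sit below [d * h] and biases from there on; among weights, division by [d] recovers the
    neuron. *)
Lemma inner_idx_inj i i' l l' : @inner_idx d h i l = inner_idx i' l' -> i = i' /\ l = l'.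
Proof.
rewrite /inner_idx; case: splitP => j lj; case: splitP => j' lj' /(congr1 val)/= e.
- have d0 : (0 < d)%N by apply: leq_ltn_trans (ltn_ord j).
  have ii' : i = i' :> nat.
    by have := congr1 (divn^~ d) e; rewrite !divnMDl// !divn_small// !addn0.
  split; apply: val_inj => //=.
  by rewrite lj lj'; move/eqP: e; rewrite ii' eqn_add2l => /eqP.
- by have := weight_lt i j; rewrite e ltnNge leq_addr.
- by have := weight_lt i' j'; rewrite -e ltnNge leq_addr.
- by split; apply: val_inj => /=; [exact: addnI e|rewrite lj lj' !ord1].
Qed.

Lemma outer_idx_inj : injective (@outer_idx d h).
Proof. by move=> i i' /(congr1 val)/= /addnI /val_inj. Qed.

Lemma inner_outer_neq i i' l : @inner_idx d h i l != outer_idx i'.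
Proof. by rewrite -val_eqE ltn_eqF// (leq_trans (inner_idx_lt i l))// leq_addr. Qed.

Lemma inner_const_neq i l : @inner_idx d h i l != const_idx.
Proof. by rewrite -val_eqE ltn_eqF//= (leq_trans (inner_idx_lt i l))// leq_add2l leq_pmull. Qed.

Lemma outer_const_neq i : @outer_idx d h i != const_idx.
Proof. by rewrite -val_eqE ltn_eqF//= -addnA ltn_add2l mul2n -addnn ltn_add2l. Qed.

(** Distinct kinds of parameters occupy distinct positions, so a network can be assembled neuron by
    neuron. *)
Lemma parameter_exists (psi : 'I_h -> 'rV[R]_(d + 1)) (v : 'I_h -> R) (c : R) :
  exists theta, [/\ forall i, inner theta i = psi i,
    forall i, theta 0 (outer_idx i) = v i & theta 0 const_idx = c].
Proof.
exists (\row_p if [pick il | inner_idx il.1 il.2 == p] is Some il then psi il.1 0 il.2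
  else if [pick i | outer_idx i == p] is Some i then v i else c).
split => [i|i|].
- apply/rowP => l; rewrite !mxE; case: pickP => [[i' l']/= /eqP/inner_idx_inj[-> ->]//|].
  by move=> /(_ (i, l)); rewrite eqxx.
- rewrite mxE; case: pickP => [[i' l']/=|_]; first by rewrite (negbTE (inner_outer_neq _ _ _)).
  case: pickP => [i' /eqP/outer_idx_inj ->//|/(_ i)]; by rewrite eqxx.
- rewrite mxE; case: pickP => [[i' l']/=|_]; first by rewrite (negbTE (inner_const_neq _ _)).
  by case: pickP => [i' |//]; rewrite (negbTE (outer_const_neq _)).
Qed.

Lemma set_inner_innerE theta i psi l : set_inner theta i psi 0 (inner_idx i l) = psi 0 l.
Proof.
by rewrite mxE; case: pickP => [l' /eqP/inner_idx_inj[_ ->]//|/(_ l)]; rewrite eqxx.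
Qed.

Lemma set_inner_notin theta i psi p : (forall l, inner_idx i l != p) ->
  set_inner theta i psi 0 p = theta 0 p.
Proof. by move=> ip; rewrite mxE; case: pickP => [l|//]; rewrite (negbTE (ip l)). Qed.

Lemma inner_set_inner theta i psi i' :
  inner (set_inner theta i psi) i' = if i' == i then psi else inner theta i'.
Proof.
apply/rowP => l; rewrite mxE; case: eqVneq => [->|i'i]; first exact: set_inner_innerE.
rewrite set_inner_notin ?mxE// => l'; apply: contra_neq i'i.
by move=> /inner_idx_inj[].
Qed.

Lemma set_inner_id theta i : set_inner theta i (inner theta i) = theta.
Proof.
apply/rowP => p; rewrite mxE; case: pickP => [l /eqP <-//|//].
by rewrite mxE.
Qed.

(** Turns the increment in a partial derivative into a change of the inner parameters of one
    neuron. *)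
Lemma set_inner_delta theta i l (t : R) :
  t *: delta_mx 0 (inner_idx i l) + theta =
  set_inner theta i (t *: delta_mx 0 l + inner theta i).
Proof.
apply/rowP => p; rewrite !mxE eqxx/=; case: pickP => [l' /eqP <-|ip].
  rewrite !mxE eqxx/=; congr (_ * (nat_of_bool _)%:R + _).
  by apply/eqP/eqP => [/inner_idx_inj[]//|->].
by rewrite eq_sym ip mulr0 add0r.
Qed.

End parameters.

Section neurons.
Context {R : realType} {d : nat}.
Implicit Types (psi : 'rV[R]_(d + 1)) (x : 'rV[R]_d).

Definition preactivation psi x : R :=
  psi 0 (rshift d ord0) + \sum_(j < d) psi 0 (lshift 1 j) * x 0 j.

Lemma networkE h sigma (theta : 'rV[R]_(nparam d h)) x :
  network sigma theta x = theta 0 const_idx +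
    \sum_i theta 0 (outer_idx i) * sigma (preactivation (inner theta i) x).
Proof.
rewrite /network; congr (_ + _); apply: eq_bigr => i _; congr (_ * sigma _).
rewrite /preactivation inner_bias; congr (_ + _).
by apply: eq_bigr => j _; rewrite inner_weight.
Qed.

(** For [a <= b], each maximum is that of a linear function over the interval, so the condition says
    that the largest preactivation over the cube is negative. *)
Definition inactive (a b : R) : set 'rV[R]_(d + 1) :=
  [set psi | \sum_(j < d) Num.max (psi 0 (lshift 1 j) * a) (psi 0 (lshift 1 j) * b)
    < - psi 0 (rshift d ord0)].

Lemma inactive_preactivation (a b : R) psi x :
  inactive a b psi -> cube a b x -> preactivation psi x < 0.
Proof.
move=> ipsi xab; rewrite /preactivation -ltrBrDl sub0r; apply: le_lt_trans ipsi.
apply: ler_sum => j _; have /andP[ax xb] := xab j; rewrite le_max.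
have [p0|p0] := leP 0 (psi 0 (lshift 1 j)).
  by apply/orP; right; rewrite ler_wpM2l.
by apply/orP; left; rewrite ler_wnM2l// ltW.
Qed.

Lemma open_inactive (a b : R) : open (inactive a b).
Proof.
rewrite (_ : inactive a b = (fun psi => \sum_(j < d) Num.max (psi 0 (lshift 1 j) * a)
   (psi 0 (lshift 1 j) * b) + psi 0 (rshift d ord0)) @^-1` `]-oo, 0[); last first.
  by apply/seteqP; split => psi; rewrite /inactive/= in_itv/= -ltrBrDr sub0r.
apply: open_comp; last exact: interval_open.
have ccoord l (c : R) : continuous (fun psi : 'rV[R]_(d + 1) => psi 0 l * c).
  by move=> psi; apply: continuousM; [exact: coord_continuous|exact: cst_continuous].
move=> psi _; rewrite /prop_for/continuous_at.
apply: (@cvgD _ _ _ (nbhs psi)); last exact: coord_continuous.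
apply: cvg_big => [|j _]; first exact: add_continuous.
by apply: (@continuous_max _ _ _ _ psi); exact: ccoord.
Qed.

End neurons.

Section inactive_neuron.
Context {R : realType} {d : nat}.
Variables (sigma : R -> R) (sigma0 : forall y, y < 0 -> sigma y = 0) (a b : R).

Lemma network_set_inner_inactive h (theta : 'rV[R]_(nparam d h)) i psi psi' x :
  cube a b x -> inactive a b psi -> inactive a b psi' ->
  network sigma (set_inner theta i psi) x = network sigma (set_inner theta i psi') x.
Proof.
move=> xab ipsi ipsi'; rewrite !networkE; congr (_ + _).
  by rewrite !set_inner_notin// => l; exact: inner_const_neq.
apply: eq_bigr => i' _; congr (_ * _).
  by rewrite !set_inner_notin// => l; exact: inner_outer_neq.
rewrite !inner_set_inner; case: eqVneq => // _.
by rewrite !sigma0//; apply: inactive_preactivation xab.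
Qed.

(** The zero map is the differential, because the first-order remainder vanishes near 0. *)
Lemma locally_cst_differentiable (V W : normedModType R) (f : V -> W) (x : V) :
  (\forall y \near x, f y = f x) -> differentiable f x.
Proof.
move=> fx.
have E : f \o shift x = cst (f x) + 0 +o_ 0 id.
  apply/eqaddoP => e e0.
  have : \forall y \near (0 : V), f (y + x) = f x.
    by move: fx; rewrite (near_shift 0) subr0.
  apply: filterS => y /= fyx.
  by rewrite !fctE/= fyx addr0 subrr normr0 mulr_ge0// ltW.
have dE : 'd f x = 0 :> (V -> W).
  by apply: (diff_unique (df := \0)) => //; exact: cst_continuous.
by apply/diff_locallyP; rewrite dE; split => //; exact: cst_continuous.
Qed.

(** Inactivity is an open condition under which the empirical risk ignores the inner parameters.
    This local constancy gives both the differentiability required of the point and a zero partial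
    derivative. *)
Lemma generalized_gradient_inactive h (M : nat) (X : nat -> 'rV[R]_d) (Y : nat -> R)
    (G : 'rV[R]_(nparam d h) -> 'rV[R]_(nparam d h)) theta i l :
  (forall m, cube a b (X m)) ->
  generalized_gradient (empirical_risk sigma M X Y) G ->
  inactive a b (inner theta i) -> G theta 0 (inner_idx i l) = 0.
Proof.
move=> Xab gG itheta; set L := empirical_risk sigma M X Y in gG *.
have Lcst psi : inactive a b psi -> L (set_inner theta i psi) = L theta.
  move=> ipsi; rewrite -[in RHS](set_inner_id theta i) /L /empirical_risk.
  congr (_ * _); apply: eq_bigr => m _; congr (`|_ - _| ^+ 2).
  exact: network_set_inner_inactive.
have near_inactive : \forall psi \near inner theta i, inactive a b psi.
  by apply: open_nbhs_nbhs; split => //; exact: open_inactive.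
rewrite gG; last first.
  apply: locally_cst_differentiable; apply: filterS near_inactive => psi ipsi.
  by rewrite !Lcst.
rewrite /derive; apply: cvg_lim => //.
apply: cvg_near_cst; apply: cvg_within.
have : \forall t \near (0 : R), inactive a b (t *: delta_mx 0 l + inner theta i).
  have : t *: delta_mx 0 l + inner theta i @[t --> (0 : R)] -->
      (0 : R) *: delta_mx 0 l + inner theta i.
    by apply: cvgD; [apply: cvgZ; [exact: cvg_id|exact: cvg_cst]|exact: cvg_cst].
  rewrite scale0r add0r.
  by apply; exact: near_inactive.
apply: filterS => t it.
by rewrite /= set_inner_delta Lcst// subrr scaler0.
Qed.

Lemma network_drop_inactive h (theta : 'rV[R]_(nparam d h.+1)) (i : 'I_h.+1) :
  inactive a b (inner theta i) -> exists theta' : 'rV[R]_(nparam d h),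
  forall x, cube a b x -> network sigma theta x = network sigma theta' x.
Proof.
move=> itheta.
have [theta' [ti tv tc]] := parameter_exists (fun j => inner theta (lift i j))
  (fun j => theta 0 (outer_idx (lift i j))) (theta 0 const_idx).
exists theta' => x xab; rewrite !networkE tc; congr (_ + _).
rewrite (bigD1_ord i)//= sigma0 ?mulr0 ?add0r; last exact: inactive_preactivation xab.
by apply: eq_bigr => j _; rewrite ti tv.
Qed.

(** Provides the perturbations for the variational argument in [inf_risk_lt]. *)
Lemma network_add_neuron h (theta : 'rV[R]_(nparam d h)) (w : 'I_d -> R) (beta c : R) :
  exists theta' : 'rV[R]_(nparam d h.+1),
  forall x, network sigma theta' x =
    network sigma theta x + c * sigma (beta + \sum_j w j * x 0 j).
Proof.
have [theta' [ti tv tc]] := parameter_exists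
  (fun i : 'I_h.+1 => if unlift ord0 i is Some j then inner theta j else
     \row_l match fintype.split l with inl j => w j | inr _ => beta end)
  (fun i => if unlift ord0 i is Some j then theta 0 (outer_idx j) else c)
  (theta 0 const_idx).
exists theta' => x; rewrite !networkE tc -addrA; congr (_ + _).
rewrite big_ord_recl/= [RHS]addrC; congr (_ + _).
  rewrite ti tv unlift_none /preactivation; congr (_ * sigma (_ + _)).
    by rewrite mxE (unsplitK (inr _ ord0)).
  by apply: eq_bigr => j _; rewrite mxE (unsplitK (inl _ j)).
by apply: eq_bigr => j _; rewrite ti tv liftK.
Qed.

End inactive_neuron.

(** * The risk *)

Section risk.
Context {R : realType} {d : nat}.
Variables (a b : R) (mu : {measure set (borel_rV R d) -> \bar R}).
Variable (f : borel_rV R d -> R).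
Hypotheses (f_meas : measurable_fun (cube a b) f)
  (f_bounded : [bounded f x | x in @cube R d a b]).
Variables (k : nat) (sigma : R -> R).
Hypothesis sigmaE : forall x, sigma x = Num.max x 0 ^+ k.+1.
Hypothesis risk_fin : forall (h : nat) (theta : 'rV[R]_(nparam d h)),
    risk sigma a b mu f theta \is a fin_num.

Lemma measurable_cube : measurable (@cube R d a b).
Proof.
rewrite (_ : cube a b = \bigcap_j ((fun x : 'rV[R]_d => x 0 j) @^-1` `[a, b])); last first.
  apply/seteqP; split => x h j; first by move=> _; rewrite /= in_itv/=; exact: h.
  by have := h j I; rewrite /= in_itv.
apply: fin_bigcap_measurable => [|j _]; first exact: finite_finset.
by rewrite -[X in measurable X]setTI; exact: measurable_coord.
Qed.

Lemma cube_bounded x : cube a b x -> forall j : 'I_d, `|x 0 j| <= `|a| + `|b|.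
Proof.
move=> xab j; have /andP[ax xb] := xab j; rewrite ler_norml.
have := ler_norm b; have := ler_norm (- a); have := normr_ge0 a; have := normr_ge0 b.
by rewrite normrN => *; apply/andP; split; lra.
Qed.

Lemma measurable_sigma : measurable_fun setT sigma.
Proof.
rewrite (_ : sigma = fun x => Num.max x 0 ^+ k.+1); last exact/funext.
apply: measurable_funX; apply: measurable_maxr; last exact: measurable_cst.
exact: measurable_id.
Qed.

(** Joint measurability lets Tonelli's theorem give measurability of the risk in the parameter. *)
Lemma measurable_network_pair h : measurable_fun setT
  (fun z : borel_rV R (nparam d h) * borel_rV R d => network sigma z.1 z.2).
Proof.
have mtheta p : measurable_fun setT
    (fun z : borel_rV R (nparam d h) * borel_rV R d => z.1 0 p).
  exact: (measurableT_comp (measurable_coord p) measurable_fst).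
have mx j : measurable_fun setT
    (fun z : borel_rV R (nparam d h) * borel_rV R d => z.2 0 j).
  exact: (measurableT_comp (measurable_coord j) measurable_snd).
apply: measurable_funD => //; apply: measurable_sum => i; apply: measurable_funM => //.
apply: measurableT_comp; first exact: measurable_sigma.
apply: measurable_funD => //; apply: measurable_sum => j; exact: measurable_funM.
Qed.

Lemma measurable_network h (theta : 'rV[R]_(nparam d h)) :
  measurable_fun setT (network sigma theta : borel_rV R d -> R).
Proof.
exact: (measurableT_comp (@measurable_network_pair h)
  (pair1_measurable (theta : borel_rV R (nparam d h)))).
Qed.

Lemma neuron_bounded (w : 'I_d -> R) (beta : R) :
  exists C : R, forall x, cube a b x -> `|sigma (beta + \sum_j w j * x 0 j)| <= C.
Proof.
exists ((`|beta| + \sum_j `|w j| * (`|a| + `|b|)) ^+ k.+1) => x xab.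
have yK : `|beta + \sum_j w j * x 0 j| <= `|beta| + \sum_j `|w j| * (`|a| + `|b|).
  apply: le_trans (ler_normD _ _) _; rewrite lerD2l.
  apply: le_trans (ler_norm_sum _ _ _) _; apply: ler_sum => j _.
  by rewrite normrM ler_wpM2l ?cube_bounded.
have K0 := le_trans (normr_ge0 _) yK.
rewrite sigmaE normrX lerXn2r ?nnegrE//.
by case: (leP 0) => //; rewrite normr0.
Qed.

Lemma network_bounded h (theta : 'rV[R]_(nparam d h)) :
  exists C : R, forall x, cube a b x -> `|network sigma theta x| <= C.
Proof.
have /choice[C hC] : forall i : 'I_h, exists C : R, forall x, cube a b x ->
    `|sigma (theta 0 (bias_idx i) + \sum_j theta 0 (weight_idx i j) * x 0 j)| <= C.
  by move=> i; exact: neuron_bounded.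
exists (`|theta 0 const_idx| + \sum_i `|theta 0 (outer_idx i)| * C i) => x xab.
apply: le_trans (ler_normD _ _) _; rewrite lerD2l.
apply: le_trans (ler_norm_sum _ _ _) _; apply: ler_sum => i _.
by rewrite normrM ler_wpM2l ?hC.
Qed.

Lemma f_bound : exists C : R, forall x, cube a b x -> `|f x| <= C.
Proof.
have [M [_ hM]] := f_bounded; exists (M + 1) => x xab; apply: hM xab.
by rewrite ltrDl.
Qed.

Lemma residual_bounded h (theta : 'rV[R]_(nparam d h)) :
  exists C : R, forall x, cube a b x -> `|network sigma theta x - f x| <= C.
Proof.
have [C hC] := network_bounded theta; have [E hE] := f_bound.
exists (C + E) => x xab; apply: le_trans (ler_normB _ _) _.
by rewrite lerD ?hC ?hE.
Qed.

Lemma measurable_residual h (theta : 'rV[R]_(nparam d h)) :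
  measurable_fun (cube a b) (fun x : borel_rV R d => network sigma theta x - f x).
Proof.
apply: measurable_funB => //; apply: (@measurable_funS _ _ _ _ setT) => //.
exact: measurable_network.
Qed.

(* The network without neurons that is constantly [1 + sup |f|] has residual at least 1. *)
Lemma cube_lty : (mu (cube a b) < +oo)%E.
Proof.
have [C fC] := f_bound.
pose theta : 'rV[R]_(nparam d 0) := const_mx (1 + C).
apply: (@le_lt_trans _ _ (risk sigma a b mu f theta)); last first.
  by rewrite -ge0_fin_numE//; apply: integral_ge0 => x _; rewrite lee_fin sqr_ge0.
rewrite -[leLHS]mul1e -integral_cst; last exact: measurable_cube.
apply: ge0_le_integral => //.
- exact: measurable_cube.
- by apply/measurable_EFinP; apply: measurable_funX; exact: measurable_residual.
- move=> x xab; rewrite lee_fin /network big_ord0 addr0 mxE.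
  have : f x <= C by rewrite (le_trans (ler_norm _))// fC.
  by move=> ?; rewrite expr2; nra.
Qed.

Lemma measurable_risk h :
  measurable_fun setT (risk sigma a b mu f : borel_rV R (nparam d h) -> \bar R).
Proof.
(* Tonelli is applied to a finite measure on the whole space: [mu] is restricted to the cube, and
   [f], measurable only there, is extended by 0. *)
pose mu' := mfrestr measurable_cube cube_lty.
pose F (z : borel_rV R (nparam d h) * borel_rV R d) : \bar R :=
  ((\1_(cube a b) z.2 * (network sigma z.1 z.2 - (f \_ (cube a b)) z.2) ^+ 2)%R)%:E.
have F0 z : (0 <= F z)%E by rewrite lee_fin mulr_ge0// sqr_ge0.
have mF : measurable_fun setT F.
  apply/measurable_EFinP; apply: measurable_funM.
    apply: (measurableT_comp _ measurable_snd).
    by apply: measurable_indic; exact: measurable_cube.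
  apply: measurable_funX; apply: measurable_funB; first exact: measurable_network_pair.
  apply: (measurableT_comp _ measurable_snd).
  by apply/(measurable_restrictT _ _).1 => //; exact: measurable_cube.
rewrite (_ : risk _ _ _ _ _ = fubini_F mu' F); last first.
  apply/funext => theta; rewrite /fubini_F /risk.
  rewrite (@eq_measure_integral _ _ _ (cube a b) mu' mu); last first.
    by move=> A _ Aab; rewrite -[LHS](congr1 mu (setIidl Aab)).
  rewrite integral_mkcond; apply: eq_integral => x _.
  rewrite patchE /F /= indicE patchE; case: ifPn => xab; first by rewrite mul1r.
  by rewrite mul0r.
exact: (@measurable_fun_fubini_tonelli_F _ _ _ _ R mu' F mF F0).
Qed.

Lemma inf_risk_lt h (theta : 'rV[R]_(nparam d h)) :
  risk sigma a b mu f theta = inf_risk h sigma a b mu f ->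
  (0 < inf_risk h sigma a b mu f)%E ->
  (inf_risk h.+1 sigma a b mu f < inf_risk h sigma a b mu f)%E.
Proof.
move=> thetaE inf0; rewrite ltNge; apply/negP => inf_le.
pose g (x : borel_rV R d) := network sigma theta x - f x.
have mD := measurable_cube; have muD := cube_lty.
have mg : measurable_fun (cube a b) g := measurable_residual theta.
have bg : exists C : R, forall x, cube a b x -> `|g x| <= C := residual_bounded theta.
suff : ae_eq mu (cube a b) (EFin \o g) (cst 0%E).
  move=> g0; move: inf0; rewrite -thetaE /risk.
  rewrite (ae_eq_integral (cst 0%E)) ?integral0 ?ltxx//.
  - by apply/measurable_EFinP; exact: measurable_funX.
  - by apply: filterS g0 => x g0 Dx; have [gx0] := g0 Dx; rewrite /= -/(g x) gx0 expr0n.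
apply: (rectified_power_discriminatory mD muD mg bg (k := k)) => [x xab|w beta].
  exact: cube_bounded xab.
under eq_integral do rewrite -sigmaE.
pose s (x : borel_rV R d) := sigma (beta + \sum_j w j * x 0 j).
have ms : measurable_fun (cube a b) s.
  apply: (@measurable_funS _ _ _ _ setT) => //.
  apply: measurableT_comp; first exact: measurable_sigma.
  apply: measurable_funD => //; apply: measurable_sum => j; apply: measurable_funM => //.
  exact: measurable_coord.
have bs : exists C : R, forall x, cube a b x -> `|s x| <= C := neuron_bounded w beta.
have igg : mu.-integrable (cube a b) (fun x => (g x * g x)%:E) by exact: integrable_gmul.
have igs : mu.-integrable (cube a b) (fun x => (g x * s x)%:E) by exact: integrable_gmul.
have iss : mu.-integrable (cube a b) (fun x => (s x * s x)%:E) by exact: integrable_gmul.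
(* Adding [c] times the neuron [s] cannot lower the risk; the right-hand side is the expanded risk
   of the enlarged network. *)
have quad (c : R) : (\int[mu]_(x in cube a b) (g x * g x)%:E <=
    \int[mu]_(x in cube a b) (g x * g x)%:E +
    ((2 * c)%:E * \int[mu]_(x in cube a b) (g x * s x)%:E +
     (c ^+ 2)%:E * \int[mu]_(x in cube a b) (s x * s x)%:E))%E.
  have [theta' theta'E] := network_add_neuron sigma theta w beta c.
  have : (risk sigma a b mu f theta <= risk sigma a b mu f theta')%E.
    rewrite thetaE (le_trans inf_le)//; apply: ereal_inf_lbound.
    by exists theta'.
  rewrite /risk; under eq_integral do rewrite expr2.
  congr (_ <= _)%E; rewrite -!integralZl// -!integralD//; last 3 first.
  - by apply: integrableD => //; exact: integrableZl.
  - exact: integrableZl.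
  - exact: integrableZl.
  apply: eq_integral => x _; rewrite theta'E -!EFinM -!EFinD; congr (_%:E).
  by rewrite /g /s; ring.
have := quad; rewrite -(fineK (integrable_fin_num mD igg)) -(fineK (integrable_fin_num mD igs)).
rewrite -(fineK (integrable_fin_num mD iss)).
have : 0 <= fine (\int[mu]_(x in cube a b) (s x * s x)%:E)%E.
  by apply: fine_ge0; apply: integral_ge0 => x _; rewrite lee_fin -expr2 sqr_ge0.
set B := fine (\int[mu]_(x in _) (s x * s x)%:E)%E.
set A := fine (\int[mu]_(x in _) (g x * s x)%:E)%E.
move: A B (fine _) => A B C B0 {}quad; congr (_%:E).
(* The minimizer of the quadratic would be [- A / B]; adding 1 to the denominator covers [B = 0] and
   still makes the increment negative unless [A = 0]. *)
have := quad (- (A / (B + 1))); rewrite -!EFinM -!EFinD lee_fin lerDl.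
have B1 : 0 < B + 1 by lra.
have -> : 2 * - (A / (B + 1)) * A + (- (A / (B + 1))) ^+ 2 * B =
    - ((B + 2) * (A / (B + 1)) ^+ 2).
  by field; rewrite gt_eqF.
rewrite oppr_ge0 pmulr_rle0; last lra.
move=> h0; have : (A / (B + 1)) ^+ 2 == 0 by rewrite eq_le h0 sqr_ge0.
by rewrite sqrf_eq0 mulf_eq0 invr_eq0 (gt_eqF B1) orbF => /eqP.
Qed.

End risk.

(** * Inactive neurons along the iteration *)

Lemma limn_einf_ge (R : realType) (u : (\bar R)^nat) (l : \bar R) :
  (forall n, (l <= u n)%E) -> (l <= limn_einf u)%E.
Proof.
move=> lu; rewrite limn_einf_lim; apply: lime_ge; first exact: is_cvg_einfs.
by near=> n; apply: le_ereal_inf_tmp => _ [m _ <-].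
Unshelve. all: by end_near.
Qed.

Lemma measurable_limn_einf_le d (T : measurableType d) (R : realType)
    (u : nat -> T -> \bar R) (l : \bar R) :
  (forall n, measurable_fun setT (u n)) ->
  measurable [set x | (limn_einf (u ^~ x) <= l)%E].
Proof.
move=> mu_.
rewrite -[X in measurable X]setTI.
apply: (measurable_lee measurableT _ (measurable_cst l)).
apply: measurableT_comp => //; apply: measurable_fun_limn_esup => n.
exact: measurableT_comp.
Qed.

(** Powers of [1 - p <= expR (- p)], monotone because [1 - p] is nonnegative. *)
Lemma expr_1B_le_expR (R : realType) (p : R) (n : nat) :
  p <= 1 -> (1 - p) ^+ n <= expR (- (n%:R * p)).
Proof.
move=> p1; rewrite -mulrN expRM_natl lerXn2r ?nnegrE ?subr_ge0 ?expR_ge0//.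
exact: expR_ge1Dx.
Qed.

Lemma inactive_neuron_frozen (R : realType) (d h : nat) (a b : R) (sigma : R -> R)
    (sigma0 : forall y, y < 0 -> sigma y = 0)
    (M : nat -> nat) (X : nat -> nat -> 'rV[R]_d) (Y : nat -> nat -> R)
    (X_cube : forall n m, cube a b (X n m))
    (G : nat -> 'rV[R]_(nparam d h) -> 'rV[R]_(nparam d h))
    (G_grad : forall n, generalized_gradient (empirical_risk sigma (M n) (X n) (Y n)) (G n))
    (theta : nat -> 'rV[R]_(nparam d h))
    (Phi : forall n, 'M[R]_(n.+1, nparam d h) -> 'rV[R]_(nparam d h))
    (Phi0 : forall n (g : 'M[R]_(n.+1, nparam d h)) (j : 'I_(nparam d h)),
      \sum_(i < n.+1) `|g i j| = 0 -> Phi n g 0 j = 0)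
    (theta_step : forall n,
      theta n.+1 = theta n - Phi n (\matrix_(i < n.+1) G i (theta i)))
    (i : 'I_h) (n : nat) :
  inactive a b (inner (theta 0%N) i) -> inner (theta n) i = inner (theta 0%N) i.
Proof.
move=> i0.
(* Strong induction: [Phi n] sees all past gradients, so every earlier iterate must have neuron [i]
   inactive for the column in [Phi0] to vanish. *)
suff: forall m, (m <= n)%N -> inner (theta m) i = inner (theta 0%N) i by apply.
elim: n => [|n IHn] m; first by rewrite leqn0 => /eqP ->.
rewrite leq_eqVlt => /predU1P[->|]; last exact: IHn.
rewrite -(IHn n)//; apply/rowP => l; rewrite !mxE theta_step !mxE Phi0 ?subr0//.
apply: big1 => j _; rewrite mxE.
rewrite (generalized_gradient_inactive sigma0 l (X_cube j) (G_grad j)) ?normr0//.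
by rewrite IHn// -ltnS.
Qed.

Theorem theorem4p2 (R : realType) (d : nat) (d_gt0 : (0 < d)%N)
  (a b : R) (ab : a <= b)
  (mu : {measure set (borel_rV R d) -> \bar R})
  (f : borel_rV R d -> R)
  (f_meas : measurable_fun (cube a b) f)
  (f_bounded : [bounded f x | x in @cube R d a b])
  (k : nat) (k_gt0 : (0 < k)%N)
  (sigma : R -> R) (sigmaE : forall x, sigma x = Num.max x 0 ^+ k)
  (risk_fin : forall (h : nat) (theta : 'rV[R]_(nparam d h)),
    risk sigma a b mu f theta \is a fin_num)
  (dO : measure_display) (Omega : measurableType dO) (P : probability Omega R)
  (X : forall n m : nat, {RV P >-> borel_rV R d})
  (X_cube : forall n m w, cube a b (X n m w))
  (Y : forall n m : nat, {RV P >-> R})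
  (M : nat -> nat -> nat) (M_gt0 : forall h n, (0 < M h n)%N)
  (G : forall h n : nat,
    'rV[R]_(nparam d h) -> Omega -> 'rV[R]_(nparam d h))
  (G_grad : forall (h n : nat) (w : Omega),
    generalized_gradient
      (empirical_risk sigma (M h n) (fun m => X n m w) (fun m => Y n m w))
      (fun theta => G h n theta w))
  (Theta : forall h n : nat, {RV P >-> borel_rV R (nparam d h)})
  (Phi : forall h n : nat, 'M[R]_(n.+1, nparam d h) -> 'rV[R]_(nparam d h))
  (Phi0 : forall (h n : nat) (g : 'M[R]_(n.+1, nparam d h))
      (j : 'I_(nparam d h)),
    \sum_(i < n.+1) `|g i j| = 0 -> Phi h n g 0 j = 0)
  (Theta_step : forall (h n : nat) (w : Omega),
    (Theta h n.+1 w : 'rV[R]_(nparam d h)) =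
    (Theta h n w : 'rV[R]_(nparam d h)) -
      Phi h n (\matrix_(i < n.+1) G h i (Theta h i w) w))
  (h : nat) (h_gt0 : (0 < h)%N)
  (Theta_iid : iid P
    (fun (i : 'I_h) w => inner (Theta h 0%N w) i : borel_rV R (d + 1)))
  (min_attained : exists theta : 'rV[R]_(nparam d h.-1),
    risk sigma a b mu f theta = inf_risk h.-1 sigma a b mu f /\
    (0 < inf_risk h.-1 sigma a b mu f)%E) :
  let theta0 w : 'rV[R]_(nparam d h) := Theta h 0%N w in
  let i1 : 'I_h := Ordinal h_gt0 in
  (P [set w | limn_einf (fun n => risk sigma a b mu f (Theta h n w))
              <= inf_risk h sigma a b mu f]
   <= (expR (- (h%:R *
         fine (P [set w | (\sum_(j < d)
                 Num.max (theta0 w 0 (weight_idx i1 j) * a)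
                         (theta0 w 0 (weight_idx i1 j) * b)
               < - theta0 w 0 (bias_idx i1))%R]))))%:E)%E.
Proof.
cbv zeta.
(* A positive power is what makes [sigma] vanish on negative numbers. *)
case: k k_gt0 sigmaE => [//|k'] _ sigmaE'.
have sigma0 y : y < 0 -> sigma y = 0.
  by move=> y0; rewrite sigmaE' max_r ?expr0n// ltW.
case: h h_gt0 Theta_iid min_attained => [//|h'] h_gt0' [mZ indZ idZ] /=.
move=> [thetam [thetamE inf0]]; set i1 := Ordinal h_gt0'.
pose Z (i : 'I_h'.+1) w : borel_rV R (d + 1) := inner (Theta h'.+1 0%N w) i.
rewrite -/Z in indZ idZ.
have minact : measurable (inactive a b : set (borel_rV R (d + 1))).
  by apply: borel_rV_open; exact: open_inactive.
have mZinact i (B : set (borel_rV R (d + 1))) : measurable B -> measurable (Z i @^-1` B).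
  by move=> mB; rewrite -[X in measurable X]setTI; exact: mZ.
rewrite [X in fine (P X)](_ : _ = Z i1 @^-1` inactive a b); last first.
  apply/funext => w; rewrite /Z /inactive /= inner_bias.
  by under [in RHS]eq_bigr do rewrite inner_weight.
set E := [set w | _].
(* Needed for monotonicity of [P]; this is where measurability of the risk in the parameter
   enters. *)
have mE : measurable E.
  apply: measurable_limn_einf_le => n.
  apply: measurableT_comp; last exact: measurable_funPT.
  exact: (measurable_risk f_meas f_bounded sigmaE' risk_fin).
(* One initially inactive neuron keeps every risk at or above the infimum for [h'] neurons, which
   strictly exceeds the one for [h'.+1]; so [E] forces all neurons to start outside [inactive]. *)
have EN : E `<=` \bigcap_(i in [set` [set: 'I_h'.+1]%SET]) Z i @^-1` (~` inactive a b).
  move=> w Ew i _ /= iw; move: Ew; rewrite /E /= leNgt => /negP; apply.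
  apply: lt_le_trans (inf_risk_lt f_meas f_bounded sigmaE' risk_fin thetamE inf0) _.
  apply: limn_einf_ge => n.
  have frozen : inner (Theta h'.+1 n w) i = inner (Theta h'.+1 0%N w) i.
    exact: (inactive_neuron_frozen sigma0 (fun n m => X_cube n m w)
      (fun n => G_grad h'.+1 n w) (@Phi0 h'.+1) (fun n => Theta_step h'.+1 n w) n iw).
  have iwn : inactive a b (inner (Theta h'.+1 n w) i) by rewrite frozen.
  have [theta' theta'E] := network_drop_inactive sigma0 iwn.
  apply: (@le_trans _ _ (risk sigma a b mu f theta')).
    by apply: ereal_inf_lbound; exists theta'.
  rewrite le_eqVlt; apply/orP; left; apply/eqP.
  by apply: eq_integral => x; rewrite inE => xab; rewrite theta'E.
have mN : measurable (~` inactive a b : set (borel_rV R (d + 1))) by exact: measurableC.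
(* Independence makes the probability of the intersection a product, and equal laws make all factors
   that of neuron [i1]. *)
apply: (@le_trans _ _ ((1 - fine (P (Z i1 @^-1` inactive a b))) ^+ h'.+1)%:E).
  apply: le_trans (le_measure _ _ _ EN) _; rewrite ?inE//.
    apply: fin_bigcap_measurable => [|i _]; first exact: finite_finset.
    exact: mZinact.
  have /= -> := indZ [set: 'I_h'.+1]%SET (fun=> ~` inactive a b) (fun _ _ => mN).
  rewrite (eq_bigr (fun=> (1 - fine (P (Z i1 @^-1` inactive a b)))%:E)).
    by rewrite prodEFin prodr_const cardsT card_ord.
  move=> i _; rewrite (idZ i i1 _ mN : P _ = P _) preimage_setC.
  rewrite probability_setC; last exact: (mZinact i1 _ minact).
  by rewrite EFinB fineK// fin_num_measure//; exact: (mZinact i1 _ minact).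
rewrite lee_fin; apply: expr_1B_le_expR.
rewrite -lee_fin fineK ?fin_num_measure ?probability_le1//.
all: exact: (mZinact i1 _ minact).
Qed.
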